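(* Let $\mathbf{K}$ be a field of characteristic $p>0$. Let $a\in\mathbf{K}$ be an element which does not lie in $\{x^p-x : x\in\mathbf{K}\}$. Then $\mathbf{L}:=\mathbf{K}[X]/(X^p-X-a)$ is a cyclic field extension of $\mathbf{K}$ of degree $p$, and there is a normal basis of $\mathbf{L}$ over $\mathbf{K}$ with weight $\le 3p-2$ and complexity $O\big(p\,(\log p)\,|\log|\log p||\big)$, the constant implied by $O$ being absolute (independent of $\mathbf{K}$, $p$ and $a$).
   Context: Let $\mathbf{L}/\mathbf{K}$ be a cyclic Galois extension of fields of degree $n$, with $\sigma$ a generator of $\mathrm{Gal}(\mathbf{L}/\mathbf{K})$. A normal basis of $\mathbf{L}$ over $\mathbf{K}$ is a $\mathbf{K}$-basis of the form $(\theta,\sigma(\theta),\ldots,\sigma^{n-1}(\theta))$ with $\theta\in\mathbf{L}^*$. Let $\Theta=(\theta_i)_{0\le i\le n-1}$ be a $\mathbf{K}$-basis of $\mathbf{L}$, and let $t_{i,j}^k\in\mathbf{K}$ be defined by $\theta_i\theta_j=\sum_{k=0}^{n-1}t_{i,j}^k\theta_k$. Complexity: consider straight-line programs that compute the coordinates in $\Theta$ of the product $a\times b$ from the coordinates in $\Theta$ of arbitrary $a,b\in\mathbf{L}$, and that consist of additions, subtractions, multiplications of a register by a constant (in $\mathbf{K}$), and additions, subtractions, multiplications between two registers (registers hold elements of $\mathbf{K}$). The complexity of such a program is the total number of such operations. The complexity of the basis $\Theta$ is the minimal possible complexity of such a program. Weight: when $\Theta$ is a normal basis, its weight is the number of non-zero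 terms in the bilinear form $c_0(a,b)=\sum_{i,j}t_{i,j}^0a_ib_j$, i.e. the number of pairs $(i,j)$ with $0\le i,j\le n-1$ and $t_{i,j}^0\neq 0$. $\log$ denotes the natural logarithm. *)

(* Defs.v *)
From HB Require Import structures.
From mathcomp Require Import all_boot all_order all_fingroup all_algebra.
From mathcomp Require Import all_solvable all_field.

Set Implicit Arguments.
Unset Strict Implicit.
Unset Printing Implicit Defensive.

Import GRing.Theory.
Local Open Scope ring_scope.

(* MathComp attaches Galois groups to splittingFieldType: a finite extension
   L/F together with the Prop-valued axiom that L is a splitting field over F
   (that is, normal). *)
Definition splitting_of (F : fieldType) (L : fieldExtType F)
    (hL : SplittingField.axiom L) : splittingFieldType F :=
  HB.pack L (FieldExt_isSplittingField.Build F L hL).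

Section Bases.
Variables (K : fieldType) (L : fieldExtType K) (n : nat).
Implicit Types (Theta : n.-tuple L).

(* t_{i,j}^k; only meaningful when Theta is a basis of L over K. *)
Definition structure_constant Theta (i j k : 'I_n) : K :=
  coord Theta k (tnth Theta i * tnth Theta j).

(* Number of nonzero terms of c_0; the coordinate k is the one of index 0
   (there is exactly one as soon as 0 < n). *)
Definition weight Theta : nat :=
  #|[set ij : 'I_n * 'I_n |
     [exists k : 'I_n, (k == 0 :> nat)
                       && (structure_constant Theta ij.1 ij.2 k != 0)]]|.

Definition coordinates Theta (x : L) : seq K :=
  [seq coord Theta i x | i <- enum 'I_n].

End Bases.

(* Straight-line programs in single-assignment form: the registers hold the
   inputs, and each instruction appends its result as a new register.
   Natural numbers are register indices. *)
Inductive instr (K : Type) : Type :=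
  | AddConst of nat & K
  | SubConst of nat & K
  | MulConst of nat & K
  | AddReg of nat & nat
  | SubReg of nat & nat
  | MulReg of nat & nat.

Definition operands (K : Type) (o : instr K) : seq nat :=
  match o with
  | AddConst i _ | SubConst i _ | MulConst i _ => [:: i]
  | AddReg i j | SubReg i j | MulReg i j => [:: i; j]
  end.

Definition exec (K : fieldType) (r : seq K) (o : instr K) : K :=
  match o with
  | AddConst i c => r`_i + c
  | SubConst i c => r`_i - c
  | MulConst i c => r`_i * c
  | AddReg i j => r`_i + r`_j
  | SubReg i j => r`_i - r`_j
  | MulReg i j => r`_i * r`_j
  end.

Definition run (K : fieldType) (P : seq (instr K)) (r : seq K) : seq K :=
  foldl (fun r o => rcons r (exec r o)) r P.

(* Instructions only read existing registers when P is started with m of them;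
   so the default value of r`_i in exec is never used. *)
Fixpoint well_formed (K : Type) (m : nat) (P : seq (instr K)) : bool :=
  if P is o :: Q then all (fun i => i < m)%N (operands o) && well_formed m.+1 Q
  else true.

(* The inputs are the coordinates of a followed by those of b; out lists the
   registers where the coordinates of the product are found. *)
Definition computes_product (K : fieldType) (L : fieldExtType K) (n : nat)
    (Theta : n.-tuple L) (P : seq (instr K)) (out : n.-tuple nat) : Prop :=
  [/\ well_formed (n + n) P,
      all (fun i => i < n + n + size P)%N out
    & forall a b : L,
        [seq (run P (coordinates Theta a ++ coordinates Theta b))`_i | i <- out]
        = coordinates Theta (a * b)].

Definition is_complexity (K : fieldType) (L : fieldExtType K) (n : nat)
    (Theta : n.-tuple L) (c : nat) : Prop :=
  (exists P out, computes_product Theta P out /\ size P = c)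
  /\ (forall P out, computes_product Theta P out -> (c <= size P)%N).

Definition galois_conjugates (K : fieldType) (L : splittingFieldType K)
    (n : nat)
    (sigma : gal_of {:L}) (theta : L) : n.-tuple L :=
  [tuple (sigma ^+ i)%g theta | i < n].
Arguments galois_conjugates {K L} n sigma theta.

Definition is_normal_basis (K : fieldType) (L : splittingFieldType K) (n : nat)
    (sigma : gal_of {:L}) (theta : L) : bool :=
  (theta != 0) && basis_of {:L} (galois_conjugates n sigma theta).
Arguments is_normal_basis {K L} n sigma theta.

(* Main.v *)
Require Import Defs.
From mathcomp Require Import all_boot all_order all_fingroup all_algebra.
From mathcomp Require Import all_solvable all_field.
From mathcomp Require Import reals exp.
From mathcomp Require Import classical_sets boolp functions sequences.
From mathcomp Require Import zify ring lra.

Set Implicit Arguments.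
Unset Strict Implicit.
Unset Printing Implicit Defensive.

Import Order.TTheory GRing.Theory Num.Theory.
Local Open Scope ring_scope.

(** Let [x] be the class of [X], so that [x ^ p - x = a]. The translates [x + i],
with [i] in the prime field, are the roots of [X ^ p - X - a]; hence the
extension is Galois, of prime degree [p], and a generator [sigma] of its group
maps [x] to [x + c] with [c != 0] in the prime field. The normal basis comes
from [theta = 1 / x]: its elements are [y_i = 1 / (x + c i)], and they are free
because partial fractions with distinct simple poles are, [x] having degree [p]
(lemma [free_pole_inverses]).

Weight. For [i != j], partial fractions give
  [y_i y_j = (y_i - y_j) / (c (j - i))],
whose coordinate of index 0 vanishes unless [i] or [j] is 0. With the [p]
squares, this leaves at most [p + 2 (p - 1)] pairs (lemma [weight_le]).

Complexity. As [sigma] permutes the [y_i] cyclically, [y_i ^ 2] is the sum of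
the [s_k y_(i+k)], where the [s_k] are the coordinates of [y_0 ^ 2]. The
coordinate of index [k] of the product of the elements with coordinates
[alpha] and [beta] is thus (lemma [product_formula])
  [alpha_k (d * beta)_k + beta_k (d * alpha)_k + (s' * (alpha beta))_k],
where the star is cyclic correlation of length [p] and the vectors [d] and [s']
are constant: [d_j = 1 / (c j)], which is 0 for [j = 0], and [s'_j = s_(- j)].
So the product costs three correlations by constant vectors, and [5 p] further
operations.

A correlation by a constant vector is a linear map, and a linear straight-line
program computes it within [O (p log p log log p)] operations as soon as 2 is
invertible, that is, for all [p] but 2, which only matters for the constant. The
method is that of Schoenhage and Strassen. A correlation of length [p] is
embedded in the action of a polynomial in the shift operator on sequences that
change sign after [2 ^ m] steps. Such a sequence is folded into an array whose
rows change sign after about [2 ^ (m / 2)] steps, so that the shift of the rows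
is a root of unity of order a power of 2, whichever field is at hand. The
sequence of the rows is then split into eigenvectors of the shift between rows
(lemma [twisted_cost]), on each of which the operator acts as a polynomial in
the shift of the rows; this is the same problem, for sequences of length about
[2 ^ (m / 2)] (lemma [correlation_cost_rec]). *)

(** * Straight-line computations *)

Lemma periodic_mul (T : Type) p (F : nat -> T) : (forall i, F (i + p)%N = F i) ->
  forall q i, F (i + q * p)%N = F i.
Proof. by move=> per; elim=> [|q IHq] i; rewrite ?addn0 // mulSnr addnA per. Qed.

Section Circuits.
Local Open Scope classical_set_scope.
Variables (K : fieldType) (V : lmodType K) (mul : V -> V -> V).
Implicit Types (S T U : set V) (s : seq V).

(** Registers are vectors of a space [V], which will consist of functions of the
inputs. The product [mul] is arbitrary, so that the theory of linear programs
applies to any space. *)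
Inductive gate S : V -> Prop :=
  | GateAdd u v of S u & S v : gate S (u + v)
  | GateSub u v of S u & S v : gate S (u - v)
  | GateScale c u of S u : gate S (c *: u)
  | GateMul u v of S u & S v : gate S (mul u v).

Fixpoint circuit S s : Prop :=
  if s is v :: s' then gate S v /\ circuit (v |` S) s' else True.

(** Sets of available values, instead of numbered registers, make renumbering
and repetition of registers free of charge, and composition immediate. *)
Definition computable S c T : Prop :=
  exists s, [/\ (size s <= c)%N, circuit S s & T `<=` S `|` [set` s]].

Lemma gate_sub S S' v : S `<=` S' -> gate S v -> gate S' v.
Proof. by move=> sub; case=> *; constructor; apply: sub. Qed.

Lemma circuit_sub S S' s : S `<=` S' -> circuit S s -> circuit S' s.
Proof.
elim: s S S' => //= v s IHs S S' sub [gv cs]; split; first exact: gate_sub gv.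
by apply: IHs cs; apply: setUS.
Qed.

Lemma circuit_cat S s s' :
  circuit S s -> circuit (S `|` [set` s]) s' -> circuit S (s ++ s').
Proof.
elim: s S => [|v s IHs] S /=.
  by move=> _; apply: circuit_sub => x [|].
case=> gv cs cs'; split=> //; apply: IHs => //.
apply: circuit_sub cs' => x [Sx|/=]; first by left; right.
by rewrite inE => /predU1P[->|xs]; [left; left | right].
Qed.

Lemma computable_sub S S' c c' T T' : S `<=` S' -> T' `<=` T -> (c <= c')%N ->
  computable S c T -> computable S' c' T'.
Proof.
move=> subS subT le_c [s [sz cs sub]]; exists s; split.
- exact: leq_trans le_c.
- exact: circuit_sub cs.
- by move=> x /subT/sub[/subS|]; [left | right].
Qed.

Lemma computable_id S T : T `<=` S -> computable S 0 T.
Proof. by move=> sub; exists [::]; split=> // x /sub; left. Qed.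

Lemma computable_gate S v : gate S v -> computable S 1 [set v].
Proof. by move=> gv; exists [:: v]; split=> // x ->; right; rewrite /= inE. Qed.

Lemma computableD S c T c' U : computable S c T -> computable (S `|` T) c' U ->
  computable S (c + c') (T `|` U).
Proof.
move=> [s [sz cs sub]] [s' [sz' cs' sub']].
have subST : S `|` T `<=` S `|` [set` s] by move=> x [Sx|/sub//]; left.
exists (s ++ s'); split; first by rewrite size_cat leq_add.
  by apply: circuit_cat => //; apply: circuit_sub cs'.
move=> x Tx; have : (S `|` [set` s] `|` [set` s']) x.
  by case: Tx => [/sub|/sub'[/subST|]]; [left | left | right].
by case=> [[]|] /= xin; [left | right | right]; rewrite //= mem_cat xin ?orbT.
Qed.

Lemma computable_trans S c T c' U :
  computable S c T -> computable T c' U -> computable S (c + c') U.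
Proof.
move=> cT cU; have cU' : computable (S `|` T) c' U.
  by apply: computable_sub cU => //; apply: subsetUr.
by have := computableD cT cU'; apply: computable_sub => // x; right.
Qed.

Lemma computableU S c T c' U :
  computable S c T -> computable S c' U -> computable S (c + c') (T `|` U).
Proof.
move=> cT cU; apply: computableD cT _.
by apply: computable_sub cU => //; apply: subsetUl.
Qed.

Lemma computable_bigcup n S c (T : nat -> set V) :
  (forall i, (i < n)%N -> computable S c (T i)) ->
  computable S (n * c) (\bigcup_(i in `I_n) T i).
Proof.
elim: n => [_|n IHn cT]; first by apply: computable_id => x [].
have cTn : computable S (n * c) (\bigcup_(i in `I_n) T i).
  by apply: IHn => i lt_in; apply: cT; apply: ltnW.
rewrite mulSnr; have := computableU cTn (cT n (leqnn _)).
apply: computable_sub => // x [i /=]; rewrite ltnS leq_eqVlt.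
by case/predU1P => [->|lt_in Tix]; [right | left; exists i].
Qed.

End Circuits.

(** * Fast correlation by a constant vector *)

Section Correlation.
Local Open Scope classical_set_scope.
Variables (K : fieldType) (V : lmodType K) (mul : V -> V -> V).
Local Notation computable := (computable mul).

(** This is the action on the sequence [c] of the polynomial of the shift operator
that has the coefficient [q.1] in degree [q.2], for [q] in [U]. Letting the
degrees be arbitrary avoids reducing polynomials modulo the relations that the
shift satisfies on particular sequences. *)
Definition correlate (U : seq (K * nat)) (c : nat -> V) (i : nat) : V :=
  \sum_(q <- U) q.1 *: c (i + q.2)%N.

Definition correlate2 (U : seq (K * (nat * nat))) (b : nat -> nat -> V)
    (x i : nat) : V :=
  \sum_(q <- U) q.1 *: b (x + q.2.1)%N (i + q.2.2)%N.

Lemma correlate_iota n (d : nat -> K) c i :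
  correlate [seq (d j, j) | j <- iota 0 n] c i = \sum_(j < n) d j *: c (i + j)%N.
Proof.
by rewrite /correlate big_map -[n in iota 0 n]subn0 -/(index_iota 0 n) big_mkord.
Qed.

Definition antiperiodic r (c : nat -> V) := forall i, c (i + r)%N = - c i.

Definition entries (b : nat -> nat -> V) : set V :=
  [set v | exists x i, v = b x i].

(** The whole range of an antiperiodic sequence contains the opposites of its
first [r] terms: using it both for the inputs and for the outputs makes changes
of sign, hence shifts, free of charge. *)
Definition correlation_cost r t := forall c U, antiperiodic r c ->
  computable (range c) t (range (correlate U c)).

Lemma computable_add S t u t' v : computable S t [set u] ->
  computable S t' [set v] -> computable S (t + t' + 1) [set u + v].
Proof.
move=> cu cv; apply: computable_trans (computableU cu cv) _.
by apply/computable_gate/GateAdd; [left | right].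
Qed.

Lemma computable_combination n (d : nat -> K) (c : nat -> V) :
  computable (range c) n.*2.+1 [set \sum_(j < n) d j *: c j].
Proof.
have cZ j a : computable (range c) 1 [set a *: c j].
  by apply/computable_gate/GateScale; exists j.
elim: n => [|n IHn]; first by rewrite big_ord0 -(scale0r (c 0%N)).
rewrite big_ord_recr; apply: computable_sub (computable_add IHn (cZ n (d n))) => //.
by rewrite doubleS !addn1.
Qed.

(** On a sequence multiplied by [a] after [r] steps, the [r]-th power of the shift
is the scalar [a], so that polynomials of the shift can be reduced to degree
less than [r]. *)
Lemma correlate_reduce r a c U : (0 < r)%N ->
  (forall i, c (i + r)%N = a *: c i) ->
  exists d : nat -> K, forall i, correlate U c i = \sum_(j < r) d j *: c (i + j)%N.
Proof.
move=> r_gt0 twist; have iter q i : c (i + q * r)%N = a ^+ q *: c i.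
  elim: q => [|q IHq]; first by rewrite addn0 scale1r.
  by rewrite mulSnr addnA twist IHq scalerA exprS.
elim: U => [|[x k] U [d IHU]].
  exists (fun=> 0) => i; rewrite /correlate big_nil big1 // => j _.
  exact: scale0r.
exists (fun j => d j + (j == k %% r)%N%:R * (x * a ^+ (k %/ r))) => i.
under eq_bigr do rewrite scalerDl.
rewrite big_split /= -IHU /correlate big_cons addrC; congr (_ + _) => /=.
rewrite (bigD1 (Ordinal (ltn_pmod k r_gt0))) //= eqxx mul1r.
rewrite big1 ?addr0 => [|j /negPf/=]; last first.
  by rewrite -val_eqE /= => ->; rewrite mul0r scale0r.
by rewrite -scalerA -iter {1}(divn_eq k r); congr (_ *: c _); lia.
Qed.

Lemma naive_correlation_cost r a n c U : (0 < r)%N -> (0 < n)%N ->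
  (forall i, c (i + r)%N = a *: c i) ->
  (forall i, c (i + n)%N = c i) ->
  computable (range c) (n * r.*2.+1) (range (correlate U c)).
Proof.
move=> r_gt0 n_gt0 twist per; have [d corE] := correlate_reduce U r_gt0 twist.
have := computable_bigcup (n := n) (T := fun i => [set correlate U c i])
                          (S := range c) (c := r.*2.+1) (mul := mul).
case=> [i _|s [sz cs sub]].
  rewrite corE; have := computable_combination r d (fun j => c (i + j)%N).
  by apply: computable_sub => // _ [j _ <-]; exists (i + j)%N.
exists s; split=> // _ [i _ <-]; apply: sub; exists (i %% n)%N => /=.
  by rewrite ltn_mod.
rewrite !corE; apply: eq_bigr => j _; rewrite {1}(divn_eq i n).
by rewrite -[in LHS]addnA addnC (periodic_mul per) addnC.
Qed.

Lemma antiperiodic_mod r c : antiperiodic r c ->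
  forall i, c i = c (i %% (2 * r))%N.
Proof.
move=> anti i; rewrite {1}(divn_eq i (2 * r)).
elim: (i %/ _)%N => [|q IHq]; first by rewrite mul0n add0n.
by rewrite mulSnr addnAC mul2n -addnn addnA !anti opprK addnn -mul2n.
Qed.

Lemma twist_iter n (b : nat -> nat -> V) e :
  (forall x i, b (x + n)%N i = b x (i + e)%N) ->
  forall q x i, b (x + q * n)%N i = b x (i + q * e)%N.
Proof.
move=> twist; elim=> [|q IHq] x i; first by rewrite !mul0n !addn0.
by rewrite mulSnr addnA twist IHq mulSnr [(q * e + e)%N]addnC addnA.
Qed.

(** By the two periodicity relations, all the entries of the array are among
those with [x < n] and [i < 2 r]. *)
Lemma computable_entries n r e S c (b : nat -> nat -> V) : (0 < n)%N -> (0 < r)%N ->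
  (forall x i, b (x + n)%N i = b x (i + e)%N) ->
  (forall x, antiperiodic r (b x)) ->
  (forall x i, computable S c [set b x i]) ->
  computable S (n * (2 * r * c)) (entries b).
Proof.
move=> n_gt0 r_gt0 twist anti cb.
have crow x : computable S (2 * r * c) (\bigcup_(i in `I_(2 * r)) [set b x i]).
  exact: computable_bigcup.
have := computable_bigcup (n := n) (fun x _ => crow x).
apply: computable_sub => // _ [x [i ->]].
exists (x %% n)%N; first by rewrite /= ltn_mod.
rewrite {2}(divn_eq x n) addnC (twist_iter twist) (antiperiodic_mod (anti _)).
by exists ((i + x %/ n * e) %% (2 * r))%N => //=; rewrite ltn_mod muln_gt0.
Qed.

Hypothesis two_neq0 : 2%:R != 0 :> K.

(** Let [X] and [Y] be the two shifts of the array, along [x] and along [i]. The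
hypotheses say that [X ^ (2 ^ k) = Y ^ e] and [Y ^ (2 ^ s) = -1] on [b]. For
[k = 0], a polynomial in [X] and [Y] acts as one in [Y], at the cost [t].
Otherwise let [n = 2 ^ (k - 1)] and [e = 2 f]. Since [X ^ (2 n) = Y ^ (2 f)], the
array [b] is half the sum of [(1 + X ^ n Y ^ - f) b], on which [X ^ n = Y ^ f], and
of [(1 - X ^ n Y ^ - f) b], on which [X ^ n = - Y ^ f = Y ^ (f + 2 ^ s)]; both are
again of the form considered. *)
Lemma twisted_cost s t : correlation_cost (2 ^ s) t -> forall k,
  (k <= s.+1)%N -> forall e b U, (2 ^ k %| e)%N ->
  (forall x i, b (x + 2 ^ k)%N i = b x (i + e)%N) ->
  (forall x, antiperiodic (2 ^ s) (b x)) ->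
  computable (entries b) (2 ^ k * (t + 6 * k * 2 ^ s))
             (entries (correlate2 U b)).
Proof.
set r := (2 ^ s)%N => cost; have r_gt0 : (0 < r)%N by rewrite expn_gt0.
elim=> [|k IHk] le_k e b U dv_e twist anti.
  have twist1 x i : b x i = b 0%N (i + x * e)%N.
    by have := twist_iter twist x 0 i; rewrite add0n muln1.
  rewrite expn0 mul1n muln0 mul0n addn0.
  have := cost _ [seq (q.1, (q.2.2 + q.2.1 * e)%N) | q <- U] (anti 0%N).
  apply: computable_sub => // [_ [i _ <-]|_ [x [i ->]]]; first by exists 0%N, i.
  exists (i + x * e)%N => //; rewrite /correlate big_map /correlate2.
  apply: eq_bigr => q _ /=; rewrite [in RHS]twist1; congr (_ *: b _ _).
  by rewrite mulnDl; lia.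
set n := (2 ^ k)%N in IHk *; have n_gt0 : (0 < n)%N by rewrite expn_gt0.
have n2 : (2 ^ k.+1 = 2 * n)%N by rewrite expnS.
rewrite n2 in dv_e twist *.
have /dvdnP[f def_e] : (2 %| e)%N by apply: dvdn_trans dv_e; apply: dvdn_mulr.
have dv_f : (n %| f)%N by move: dv_e; rewrite def_e [(f * 2)%N]mulnC dvdn_pmul2l.
have dv_r : (n %| r)%N by rewrite dvdn_exp2l.
(* As Y has order 2 * r, the exponent g stands for - f. *)
pose g := ((2 * r).-1 * f)%N.
have fg : (f + g = 2 * r * f)%N by rewrite /g -mulSn prednK // muln_gt0.
have per x i q : b x (i + 2 * r * q)%N = b x i.
  rewrite (antiperiodic_mod (anti x)) [in RHS](antiperiodic_mod (anti x)).
  by rewrite addnC [(2 * r * q)%N]mulnC modnMDl.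
have b_2n x i : b (x + n + n)%N i = b x (i + f * 2)%N.
  by rewrite -addnA addnn -mul2n twist def_e.
pose bp x i := b x i + b (x + n)%N (i + g)%N.
pose bm x i := b x i - b (x + n)%N (i + g)%N.
have antip x : antiperiodic r (bp x).
  by move=> i; rewrite /bp [(i + r + g)%N]addnAC !anti opprD.
have antim x : antiperiodic r (bm x).
  by move=> i; rewrite /bm [(i + r + g)%N]addnAC !anti opprD.
have far_shift x i : b (x + n + n)%N (i + g)%N = b x (i + f)%N.
  have -> : b x (i + f)%N = b x (i + f + 2 * r * f)%N by rewrite per.
  by rewrite b_2n; congr b; lia.
have near_shift x i : b (x + n)%N i = b (x + n)%N (i + f + g)%N.
  by rewrite -addnA fg per.
have twistp x i : bp (x + n)%N i = bp x (i + f)%N.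
  by rewrite /bp far_shift -near_shift addrC.
have twistm x i : bm (x + n)%N i = bm x (i + (f + r))%N.
  by rewrite addnA antim /bm far_shift -near_shift opprB.
have lek : (k <= s.+1)%N by apply: ltnW.
have costp := IHk lek f bp U dv_f twistp antip.
have costm := IHk lek (f + r)%N bm U (dvdn_add dv_f dv_r) twistm antim.
have cp : computable (entries b) (n * (2 * r * 1)) (entries bp).
  apply: computable_entries twistp antip _ => // x i.
  by apply/computable_gate/GateAdd; do 2!eexists.
have cm : computable (entries b) (n * (2 * r * 1)) (entries bm).
  apply: computable_entries twistm antim _ => // x i.
  by apply/computable_gate/GateSub; do 2!eexists.
have halves x i : correlate2 U b x i =
    2%:R^-1 *: (correlate2 U bp x i + correlate2 U bm x i).
  rewrite /correlate2 -big_split scaler_sumr; apply: eq_bigr => q _.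
  rewrite /= -scalerDr /bp /bm addrACA subrr addr0 -mulr2n -scaler_nat.
  by rewrite !scalerA; congr (_ *: _); field.
have cU : computable (entries (correlate2 U bp) `|` entries (correlate2 U bm))
    (2 * n * (2 * r * 2)) (entries (correlate2 U b)).
  apply: (computable_entries (e := e)) => //.
  - by rewrite muln_gt0.
  - move=> x i; apply: eq_bigr => q _.
    by rewrite addnAC twist [(i + e + _)%N]addnAC.
  - move=> x i; rewrite /correlate2 -sumrN; apply: eq_bigr => q _.
    by rewrite addnAC anti scalerN.
  move=> x i; rewrite halves; apply: (@computable_trans _ _ _ _ 1 _ 1).
    apply/computable_gate/GateAdd; [left | right]; do 2!eexists; reflexivity.
  exact/computable_gate/GateScale.
have := computable_trans (computableU (computable_trans cp costp)
                            (computable_trans cm costm)) cU.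
apply: computable_sub => //; lia.
Qed.

(** The sequence is cut into [M = 2 ^ u] interleaved subsequences, the rows of an
array: row [x] holds the [c (x + M i)] and changes sign after [2 ^ s] steps. A
polynomial in the shift of [c] can be written with degree less than [M] in the
shift [X] between rows; it sends the first [M] rows into combinations of the
first [2 M], so that the rows may be repeated with period [2 M], that is,
[X ^ (2 M) = 1]. This is an instance of [twisted_cost] when [u <= s], as the shift
of the rows has order [2 ^ (s + 1)], which is a multiple of [2 M]. *)
Lemma correlation_cost_rec s u t : (u <= s)%N -> correlation_cost (2 ^ s) t ->
  correlation_cost (2 ^ (u + s)) (2 ^ u.+1 * (t + 6 * u.+1 * 2 ^ s)).
Proof.
move=> le_us cost c U anti.
set M := (2 ^ u)%N; set r := (2 ^ s)%N; have M_gt0 : (0 < M)%N by rewrite expn_gt0.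
have rM : (2 ^ (u + s) = M * r)%N by rewrite expnD.
have M2 : (2 ^ u.+1 = 2 * M)%N by rewrite expnS.
pose b x i := c (x %% (2 * M) + M * i)%N.
have twist x i : b (x + 2 ^ u.+1)%N i = b x (i + 0)%N.
  by rewrite /b M2 modnDr addn0.
have antib x : antiperiodic r (b x).
  by move=> i; rewrite /b mulnDr addnA -rM anti.
pose W := [seq (q.1, (q.2 %% M, q.2 %/ M)%N) | q <- U].
have := twisted_cost cost (k := u.+1) le_us W (dvdn0 _) twist antib.
apply: computable_sub => // [_ [x [i ->]]|_ [i _ <-]]; first by eexists.
exists (i %% M)%N, (i %/ M)%N; rewrite /correlate /correlate2 big_map.
apply: eq_bigr => q _; congr (_ *: _); rewrite /b /= modn_small; last first.
  by rewrite mul2n -addnn; have := ltn_pmod i M_gt0; have := ltn_pmod q.2 M_gt0; lia.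
congr c; rewrite {1}(divn_eq i M) {1}(divn_eq q.2 M); lia.
Qed.

(** Halving [m] doubles the cost for each entry and adds a term linear in [m], so
the cost for each entry is [O (m log m)]; [d] counts the halvings. *)
Lemma fast_correlation_cost d m : (m <= 2 ^ d)%N ->
  correlation_cost (2 ^ m) (12 * 2 ^ m * (2 ^ d * d.+1)).
Proof.
elim: d m => [|d IHd] m le_m.
  move=> c U anti; have r_gt0 : (0 < 2 ^ m)%N by rewrite expn_gt0.
  have := naive_correlation_cost (r := 2 ^ m) (n := 2 * 2 ^ m) (a := -1) U.
  move=> /(_ c r_gt0); rewrite muln_gt0 => /(_ r_gt0) naive.
  apply: computable_sub (naive _ _) => // [|i|i].
  (* Here m is 0 or 1, and the constant 12 is large enough for both. *)
  - by case: m le_m {anti r_gt0 naive} => [|[|]].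
  - by rewrite anti scaleN1r.
  by rewrite mul2n -addnn addnA !anti opprK.
have m_split : (m = m./2 + uphalf m)%N.
  by rewrite addnC uphalf_half -addnA addnn odd_double_half.
have le_half : (m./2 <= uphalf m)%N by rewrite uphalf_half leq_addl.
have le_up : (uphalf m <= 2 ^ d)%N.
  by rewrite leq_uphalf_double; move: le_m; rewrite expnS mul2n.
move: (correlation_cost_rec le_half (IHd _ le_up)); rewrite -m_split.
move=> cost c U /(cost c U); apply: computable_sub => //.
have lt_half : (m./2.+1 <= 2 ^ d.+1)%N.
  have : (m./2 <= 2 ^ d)%N by apply: leq_trans le_up.
  by rewrite expnS; have : (0 < 2 ^ d)%N; rewrite ?expn_gt0 //; lia.
have -> : (2 ^ m = 2 ^ m./2 * 2 ^ uphalf m)%N by rewrite -expnD -m_split.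
rewrite !expnS in lt_half *.
move: (2 ^ m./2)%N (2 ^ uphalf m)%N (2 ^ d)%N lt_half => x y z le_z.
have : (x * y * (24 * (z * d.+1)) + x * y * (12 * m./2.+1) <=
        x * y * (24 * (z * d.+1)) + x * y * (12 * (2 * z)))%N.
  by rewrite leq_add2l !leq_mul2l le_z !orbT.
lia.
Qed.

(** As [2 ^ m >= 2 p], the first [p] correlations only involve terms of index
less than [2 ^ m], where the sequence may be replaced by the antiperiodic one
that agrees with it there. *)
Lemma cyclic_correlation_cost p m t c U : (0 < p)%N -> (2 * p <= 2 ^ m)%N ->
  correlation_cost (2 ^ m) t -> (forall i, c (i + p)%N = c i) ->
  computable (range c) (p + t) (range (correlate U c)).
Proof.
set N := (2 ^ m)%N => p_gt0 le_pN cost per.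
have N_gt0 : (0 < N)%N by rewrite expn_gt0.
have cmod i : c i = c (i %% p)%N by rewrite {1}(divn_eq i p) addnC (periodic_mul per).
have [|d corE] := @correlate_reduce p 1 c U p_gt0.
  by move=> i; rewrite per scale1r.
pose e i := (-1) ^+ (i %/ N)%N *: c (i %% N)%N.
have anti : antiperiodic N e.
  by move=> i; rewrite /e divnDr // divnn N_gt0 modnDr addn1 exprS mulN1r scaleNr.
have ce : computable (range c) p (range e).
  have cN : computable (range c) (p * 1) (\bigcup_(i in `I_p) [set - c i]).
    apply: computable_bigcup => i _; rewrite -scaleN1r.
    by apply/computable_gate/GateScale; exists i.
  have := computableU (computable_id mul (@subset_refl _ (range c))) cN.
  apply: computable_sub; rewrite ?add0n ?muln1 // => _ [i _ <-].
  rewrite /e -signr_odd; case: odd; last by rewrite scale1r; left; eexists.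
  right; exists (i %% N %% p)%N; first by rewrite /= ltn_mod.
  by rewrite /= scaleN1r -cmod.
have := computable_trans ce (cost e [seq (d j, j) | j <- iota 0 p] anti).
apply: computable_sub => // _ [i _ <-]; exists (i %% p)%N => //.
rewrite corE correlate_iota.
apply: eq_bigr => j _ /=; have lt_ip := ltn_pmod i p_gt0.
have lt_N : (i %% p + j < N)%N by have := ltn_ord j; lia.
by rewrite /e divn_small // modn_small // scale1r [in LHS]cmod modnDml -cmod.
Qed.

End Correlation.

(** * Irreducibility of Artin-Schreier polynomials *)

Lemma natr_inj_pchar (F : fieldType) p (pcharFp : p \in [pchar F]) i j :
  (i < p)%N -> (j < p)%N -> i%:R = j%:R :> F -> i = j.
Proof.
wlog le_ij: i j / (i <= j)%N => [IH lt_i lt_j eq_ij|_ lt_j eq_ij].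
  by case/orP: (leq_total i j) => le; [|apply: esym]; apply: IH.
have : (p %| j - i)%N by rewrite (dvdn_pcharf pcharFp) natrB // eq_ij subrr.
have [|lt_0] := posnP (j - i)%N; first by lia.
by move=> /(dvdn_leq lt_0); lia.
Qed.

Lemma uniq_translates (F : fieldType) p (pcharFp : p \in [pchar F]) (c x : F) :
  c != 0 -> uniq [seq x + c * i%:R | i <- iota 0 p].
Proof.
move=> c_neq0; rewrite map_inj_in_uniq ?iota_uniq // => i j.
rewrite !mem_iota !add0n => /= lt_i lt_j /addrI/(mulfI c_neq0).
exact: natr_inj_pchar lt_i lt_j.
Qed.

Lemma uniq_translates1 (F : fieldType) p (pcharFp : p \in [pchar F]) (x : F) :
  uniq [seq x + i%:R | i <- iota 0 p].
Proof.
have := uniq_translates pcharFp x (oner_neq0 F).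
by under eq_map do rewrite mul1r.
Qed.

Lemma irreducible_factor (F : fieldType) (q : {poly F}) : (1 < size q)%N ->
  exists2 r, irreducible_poly r & r %| q.
Proof.
have [n] := ubnP (size q); elim: n q => // n IHn q le_qn q_gt1.
apply: contrapT => no_r; apply: (no_r); exists q; last exact: dvdpp.
split=> [|d d_neq1 dv_dq]; first by [].
have q_neq0 : q != 0 by rewrite -size_poly_gt0 ltnW.
rewrite -dvdp_size_eqp // eqn_leq dvdp_leq //= leqNgt; apply/negP => lt_dq.
have d_gt1 : (1 < size d)%N.
  have : d != 0 by apply: contraTneq dv_dq => ->; rewrite dvd0p.
  by rewrite -size_poly_gt0; move: d_neq1; case: size => [|[]].
have [r irr_r dv_rd] := IHn d (leq_trans lt_dq le_qn) d_gt1.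
by apply: no_r; exists r => //; apply: dvdp_trans dv_dq.
Qed.

Section ArtinSchreierPolynomial.
Variables (F : fieldType) (p : nat) (a : F).
Hypothesis pcharFp : p \in [pchar F].
Let p_gt1 : (1 < p)%N := prime_gt1 (pcharf_prime pcharFp).
Local Notation f := ('X^p - 'X - a%:P).

Lemma size_artin_schreier : size f = p.+1.
Proof. by rewrite -addrA -opprD size_polyDl size_polyXn // size_polyN size_XaddC. Qed.

Lemma monic_artin_schreier : f \is monic.
Proof.
rewrite monicE -addrA -opprD lead_coefDl ?lead_coefXn //.
by rewrite size_polyXn size_polyN size_XaddC.
Qed.

Lemma root_artin_schreier x : root f x = (x ^+ p - x == a).
Proof. by rewrite rootE !hornerE subr_eq0. Qed.

Lemma artin_schreier_translate i : f \Po ('X + i%:R%:P) = f.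
Proof.
have pcharP : p \in [pchar {poly F}] by rewrite pchar_poly.
rewrite !rmorphB /= comp_polyC comp_polyX comp_Xn_poly -pFrobenius_autE.
rewrite rmorphD /= pFrobenius_autE polyC_natr pFrobenius_aut_nat.
by rewrite opprD addrACA subrr addr0.
Qed.

(** A polynomial of degree < p invariant under translation takes the same value
   at all the points of the prime field, so it is constant. *)
Lemma translate_inv_const (r : {poly F}) k : (0 < k < p)%N ->
  r \Po ('X + k%:R%:P) = r -> (size r <= p)%N -> (size r <= 1)%N.
Proof.
case/andP=> k_gt0 lt_kp inv_r le_rp.
have k_neq0 : k%:R != 0 :> F.
  by apply/eqP => /(natr_inj_pchar pcharFp lt_kp (ltnW p_gt1)); lia.
have val_r i : r.[k%:R * i%:R] = r.[0].
  elim: i => [|i IHi]; first by rewrite mulr0.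
  rewrite -IHi -[in RHS]inv_r horner_comp !hornerE; congr r.[_].
  by rewrite mulrS mulrDr mulr1 addrC.
suffices r_const : r - r.[0]%:P = 0.
  by rewrite -[r](subrK r.[0]%:P) r_const add0r size_polyC leq_b1.
apply: contraTeq le_rp => r_neq0; rewrite -ltnNge.
have roots_r : all (root (r - r.[0]%:P)) [seq 0 + k%:R * i%:R | i <- iota 0 p].
  by apply/allP=> _ /mapP[i _ ->]; rewrite rootE !hornerE val_r subrr.
have := max_poly_roots r_neq0 roots_r (uniq_translates pcharFp 0 k_neq0).
rewrite size_map size_iota => /leq_trans; apply.
rewrite (leq_trans (size_polyD _ _)) // size_polyN geq_max leqnn size_polyC.
have : r != 0 by apply: contraNneq r_neq0 => ->; rewrite horner0 polyC0 subrr.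
by rewrite -size_poly_gt0; case: (_ == _).
Qed.

(** Let [r] be an irreducible factor, of degree at most [p - 1]. Its [p]
translates divide [f], which is invariant under translation, and they are
pairwise distinct by [translate_inv_const], hence pairwise coprime. So [p] times
the degree of [r] is at most [p]: the factor has degree 1, and [f] has a root. *)
Lemma artin_schreier_irreducible :
  ~ (exists x : F, a = x ^+ p - x) -> irreducible_poly f.
Proof.
move=> no_root; split=> [|q q_neq1 dv_qf]; first by rewrite size_artin_schreier ltnW.
have f_neq0 : f != 0 by rewrite -size_poly_gt0 size_artin_schreier.
have q_neq0 : q != 0 by apply: contraTneq dv_qf => ->; rewrite dvd0p.
have q_gt1 : (1 < size q)%N.
  by rewrite ltn_neqAle eq_sym q_neq1 size_poly_gt0.
have [r irr_r dv_rq] := irreducible_factor q_gt1.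
have r_gt1 : (1 < size r)%N := irr_r.1.
have r_neq0 : r != 0 by rewrite -size_poly_gt0 ltnW.
rewrite -dvdp_size_eqp // eqn_leq dvdp_leq //=.
apply: leq_trans (dvdp_leq q_neq0 dv_rq).
rewrite size_artin_schreier ltnNge; apply/negP => le_rp.
have dv_rf := dvdp_trans dv_rq dv_qf.
pose t i := r \Po ('X + i%:R%:P).
have size_t i : size (t i) = size r by rewrite size_comp_poly2 // size_XaddC.
have dv_t i : t i %| f by rewrite -(artin_schreier_translate i) dvdp_comp_poly.
have t_add i j : t (i + j)%N = t j \Po ('X + i%:R%:P).
  by rewrite /t -comp_polyA comp_polyD comp_polyX comp_polyC natrD polyCD addrA.
have coprime_t i j : (i < j < p)%N -> coprimep (t i) (t j).
  case/andP=> lt_ij lt_jp; rewrite -(subnKC (ltnW lt_ij)) t_add.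
  rewrite coprimep_comp_poly // irreducible_poly_coprime //; apply/negP => dv.
  have k_in : (0 < j - i < p)%N by rewrite subn_gt0 lt_ij (leq_ltn_trans (leq_subr _ _)).
  suffices inv_r : t (j - i)%N = r.
    by have := translate_inv_const k_in inv_r le_rp; rewrite leqNgt r_gt1.
  have eq_rt : r %= t (j - i)%N by rewrite -dvdp_size_eqp // size_t.
  have lead_t : lead_coef (t (j - i)%N) = lead_coef r.
    by rewrite lead_coef_comp ?size_XaddC // lead_coefXaddC expr1n mulr1.
  have := eqp_eq eq_rt; rewrite lead_t => /scalerI -> //.
  by rewrite lead_coef_eq0.
have dv_prod n : (n <= p)%N -> \prod_(i < n) t i %| f.
  elim: n => [|n IHn] lt_np; first by rewrite big_ord0 dvd1p.
  rewrite big_ord_recr Gauss_dvdp ?IHn ?dv_t ?(ltnW lt_np) //.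
  apply: (big_ind (fun q' => coprimep q' (t n))) => [|u v cu cv|i _].
  - exact: coprime1p.
  - by rewrite coprimepMl cu.
  by apply: coprime_t; rewrite /= ltn_ord.
have := dvdp_leq f_neq0 (dv_prod p (leqnn p)).
rewrite size_artin_schreier size_prod => [|i _]; last first.
  by rewrite -size_poly_eq0 size_t size_poly_eq0.
under eq_bigr do rewrite size_t.
rewrite sum_nat_const card_ord => le_size.
have {le_size} size_r : size r = 2%N.
  apply/eqP; rewrite eqn_leq r_gt1 andbT leqNgt; apply/negP => gt_r2.
  have := leq_mul (leqnn p) gt_r2; lia.
have [x root_x] := poly2_root size_r.
apply: no_root; exists x; apply/esym/eqP.
by rewrite -root_artin_schreier (root_dvdp dv_rf).
Qed.

End ArtinSchreierPolynomial.

(** * The Galois group *)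

Section ArtinSchreierRoots.
Variables (K : fieldType) (L : fieldExtType K) (p : nat) (a : K) (x : L).
Hypothesis pcharKp : p \in [pchar K].
Hypothesis root_x : x ^+ p - x = a%:A.
Local Notation f := ('X^p - 'X - a%:P).

Let pcharLp : p \in [pchar L].
Proof. by rewrite (fmorph_pchar (in_alg L)). Qed.

Lemma artin_schreier_roots :
  map_poly (in_alg L) f = \prod_(z <- [seq x + i%:R | i <- iota 0 p]) ('X - z%:P).
Proof.
have -> : map_poly (in_alg L) f = 'X^p - 'X - (a%:A)%:P.
  by rewrite !rmorphB /= map_polyXn map_polyX map_polyC.
set g := (X in X = _).
have roots_g : all (root g) [seq x + i%:R | i <- iota 0 p].
  apply/allP=> _ /mapP[i _ ->]; rewrite root_artin_schreier.
  rewrite -(pFrobenius_autE pcharLp) rmorphD /= pFrobenius_autE.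
  by rewrite pFrobenius_aut_nat opprD addrACA subrr addr0 root_x.
have uniq_g := uniq_translates1 pcharLp x.
rewrite [LHS](all_roots_prod_XsubC _ roots_g) ?uniq_rootsE //; last first.
  by rewrite size_artin_schreier // size_map size_iota.
by rewrite (monicP (monic_artin_schreier _ pcharLp)) scale1r.
Qed.

Hypothesis gen_x : <<1; x>>%VS = fullv.

Lemma artin_schreier_splits : splittingFieldFor 1 (map_poly (in_alg L) f) {:L}.
Proof.
exists [seq x + i%:R | i <- iota 0 p]; first by rewrite artin_schreier_roots ?eqpxx.
apply/eqP; rewrite eqEsubv subvf -gen_x /=; apply/FadjoinP; split.
  exact: subv_adjoin_seq.
have p_gt0 := prime_gt0 (pcharf_prime pcharKp).
apply: seqv_sub_adjoin; apply/mapP; exists 0%N; last by rewrite addr0.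
by rewrite mem_iota.
Qed.

Lemma artin_schreier_over : map_poly (in_alg L) f \is a polyOver 1%VS.
Proof. by apply/polyOver1P; exists f. Qed.

End ArtinSchreierRoots.

Section ArtinSchreierQuotient.
Variables (K : fieldType) (f : {poly K}) (hI : monic_irreducible_poly f).
Local Notation L := {poly %/ f with hI}.
Let x : L := 'qX.

Lemma qfpoly_generated : <<1; x>>%VS = {:L}%VS.
Proof.
apply/vspaceP => u; rewrite memvf; pose q : {poly K} := val (u : {poly %/ f}).
have -> : u = \sum_(i < size q) q`_i *: x ^+ i.
  have -> : u = in_qpoly f q.
    by apply: val_inj; apply/esym/in_qpoly_small; apply: size_mk_monic.
  rewrite -[q in LHS]coefK poly_def linear_sum; apply: eq_bigr => i _.
  by rewrite linearZ rmorphXn.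
apply: memv_suml => i _; apply: memvZ; apply: rpredX; exact: memv_adjoin.
Qed.

Lemma dim_qfpoly : \dim {:L} = (size f).-1.
Proof. by rewrite dim_polyn mk_monicE. Qed.

End ArtinSchreierQuotient.

Lemma in_qpolyC (K : fieldType) (f : {poly K}) c : in_qpoly f c%:P = c%:A.
Proof. by rewrite -[c%:P]mulr1 mul_polyC linearZ rmorph1. Qed.

Lemma qfpoly_artin_schreier (K : fieldType) p (a : K)
    (hI : monic_irreducible_poly ('X^p - 'X - a%:P)) :
  let x : {poly %/ 'X^p - 'X - a%:P with hI} := 'qX in x ^+ p - x = a%:A.
Proof.
set f := 'X^p - 'X - a%:P in hI *; move=> x.
have f0 : in_qpoly f f = 0.
  by apply: val_inj; rewrite /= mk_monicE //; apply: Pdiv.RingMonic.rmodpp hI.2.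
move/eqP: f0; rewrite {2}/f !rmorphB /= rmorphXn subr_eq0 => /eqP ->.
exact: in_qpolyC.
Qed.

Lemma gal_scalar (K : fieldType) (L : splittingFieldType K)
  (sigma : gal_of {:L}) (c : K) : sigma c%:A = c%:A.
Proof. by rewrite linearZ rmorph1. Qed.

Section ArtinSchreierGalois.
Variables (K : fieldType) (L : splittingFieldType K) (p : nat) (a : K) (x : L).
Hypothesis pcharKp : p \in [pchar K].
Hypothesis root_x : x ^+ p - x = a%:A.
Hypothesis gen_x : <<1; x>>%VS = {:L}%VS.
Hypothesis dim_L : \dim {:L} = p.
Local Notation f := ('X^p - 'X - a%:P).

Let p_pr : prime p := pcharf_prime pcharKp.
Let pcharLp : p \in [pchar L].
Proof. by rewrite (fmorph_pchar (in_alg L)). Qed.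

Lemma artin_schreier_galois : galois 1%AS {:L}.
Proof.
apply/splitting_galoisField; exists (map_poly (in_alg L) f); split.
- exact: artin_schreier_over.
- rewrite (artin_schreier_roots pcharKp root_x) separable_prod_XsubC.
  exact: uniq_translates1.
exact: (artin_schreier_splits pcharKp root_x gen_x).
Qed.

Lemma card_artin_schreier_gal : #|'Gal({:L} / 1%AS)%g| = p.
Proof. by rewrite -(galois_dim artin_schreier_galois) dim_L dimv1 divn1. Qed.

Lemma artin_schreier_cyclic : cyclic 'Gal({:L} / 1%AS).
Proof. by apply: prime_cyclic; rewrite card_artin_schreier_gal. Qed.

Lemma artin_schreier_generator (sigma : gal_of {:L}) :
  generator 'Gal({:L} / 1%AS) sigma -> exists2 c : K, c != 0 & sigma x = x + c%:A.
Proof.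
move=> gen_sigma; have Gsigma : sigma \in 'Gal({:L} / 1%AS)%g.
  by rewrite (eqP gen_sigma) cycle_id.
have : root (map_poly (in_alg L) f) (sigma x).
  rewrite !rmorphB /= map_polyXn map_polyX map_polyC root_artin_schreier.
  by rewrite -rmorphXn -rmorphB root_x /= gal_scalar.
rewrite (artin_schreier_roots pcharKp root_x) root_prod_XsubC.
case/mapP=> i _ sigma_x; exists i%:R; last first.
  by rewrite sigma_x scaler_nat.
apply/eqP => i0; have fix_x : sigma x = x.
  by rewrite sigma_x -(scaler_nat i 1) i0 scale0r addr0.
have sigma1 : sigma = 1%g.
  apply/eqP/gal_eqP => u _; have: u \in <<1; x>>%VS by rewrite gen_x memvf.
  case/Fadjoin1_polyP => q ->; rewrite gal_id -horner_map /= fix_x.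
  congr _.[x]; rewrite -map_poly_comp; apply: eq_map_poly => z /=.
  by rewrite gal_scalar.
have := card_artin_schreier_gal; rewrite (eqP gen_sigma) sigma1 cycle1 cards1 => p1.
by have := prime_gt1 p_pr; rewrite -p1.
Qed.

End ArtinSchreierGalois.

(** * The normal basis of inverses of translates *)

Section NormalBasis.
Variables (K : fieldType) (L : splittingFieldType K) (p : nat) (x : L).
Hypothesis pcharKp : p \in [pchar K].
Hypothesis gen_x : <<1; x>>%VS = {:L}%VS.
Hypothesis dim_L : \dim {:L} = p.
Variables (sigma : gal_of {:L}) (c : K).
Hypothesis c_neq0 : c != 0.
Hypothesis sigma_x : sigma x = x + c%:A.

Let p_pr : prime p := pcharf_prime pcharKp.
Let p_gt0 : (0 < p)%N := prime_gt0 p_pr.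

Definition pole (i : nat) : L := x + (c * i%:R)%:A.

Lemma adjoin_degree_generator : adjoin_degree 1 x = p.
Proof. by rewrite adjoin_degreeE gen_x dim_L dimv1 divn1. Qed.

Lemma pole_neq0 i : pole i != 0.
Proof.
apply: contraTneq p_pr => /eqP; rewrite addr_eq0 => /eqP x_scalar.
suffices: adjoin_degree 1 x == 1%N by rewrite adjoin_degree_generator => /eqP->.
by rewrite adjoin_deg_eq1 x_scalar rpredN rpredZ ?rpred1.
Qed.

Lemma pole_periodic i : pole (i + p) = pole i.
Proof. by rewrite /pole natrD (pcharf0 pcharKp) addr0. Qed.

Lemma gal_pole i : sigma (pole i) = pole i.+1.
Proof.
by rewrite /pole rmorphD /= sigma_x gal_scalar -addrA -scalerDl mulrS mulrDr mulr1.
Qed.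

Lemma galX_pole i k : (sigma ^+ i)%g (pole k)^-1 = (pole (k + i))^-1.
Proof.
elim: i => [|i IHi]; first by rewrite gal_id addn0.
by rewrite expgSr galM ?memvf // IHi fmorphV /= gal_pole addnS.
Qed.

Lemma nth_galois_conjugates (i : 'I_p) :
  (galois_conjugates p sigma (pole 0)^-1)`_i = (pole i)^-1.
Proof. by rewrite -tnth_nth tnth_mktuple galX_pole. Qed.

(** After multiplication by all the poles, a linear relation between their
   inverses is an algebraic equation of degree < p for [x], so its polynomial
   is 0; its value at the opposite of a pole isolates one coefficient. *)
Lemma free_pole_inverses : free (galois_conjugates p sigma (pole 0)^-1).
Proof.
apply/freeP => k sum_k i; apply: contraTeq p_pr => ki_neq0.
pose t (j : 'I_p) : L := (c * j%:R)%:A.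
pose P : {poly L} := \sum_(j < p) (k j)%:A *: \prod_(l < p | l != j) ('X + (t l)%:P).
have P_over : P \is a polyOver 1%VS.
  apply: rpred_sum => j _; apply: polyOverZ; first by rewrite rpredZ ?rpred1.
  apply: rpred_prod => l _; rewrite rpredD ?polyOverX // polyOverC.
  by rewrite rpredZ ?rpred1.
have size_P : (size P <= p)%N.
  apply: leq_trans (size_sum _ _ _) _; apply/bigmax_leqP => j _.
  apply: leq_trans (size_scale_leq _ _) _; rewrite size_prod => [|l _]; last first.
    by rewrite -size_poly_eq0 size_XaddC.
  under eq_bigr do rewrite size_XaddC.
  rewrite sum_nat_const (eq_card (B := predC1 j)) // cardC1 card_ord; lia.
have root_P : root P x.
  rewrite rootE -(mulr0 (\prod_(j < p) pole j)) -sum_k.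
  rewrite mulr_sumr horner_sum; apply/eqP/eq_bigr => j _.
  rewrite nth_galois_conjugates hornerZ horner_prod [in RHS](bigD1 j) //=.
  rewrite -[k j *: (pole j)^-1]mulr_algl mulrCA mulrAC mulfV ?pole_neq0 // mul1r.
  congr (_ * _).
  by apply: eq_bigr => l _; rewrite !hornerE.
have P0 : P = 0.
  apply/eqP; rewrite -(root_small_adjoin_poly (K := 1%AS) (x := x)) //.
  by rewrite adjoin_degree_generator.
have := congr1 (horner^~ (- t i)) P0; rewrite horner0 horner_sum (bigD1 i) //=.
rewrite [X in _ + X]big1 ?addr0 => [|j neq_ji]; last first.
  rewrite hornerZ horner_prod (bigD1 i) 1?eq_sym //=.
  by rewrite hornerD hornerX hornerC addNr mul0r mulr0.
rewrite hornerZ horner_prod => /eqP; rewrite mulf_eq0 scaler_eq0 oner_eq0 orbF.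
rewrite (negPf ki_neq0) /= prodf_seq_eq0 => /hasP[j _ /andP[neq_ji]].
rewrite !hornerE addrC subr_eq0 -subr_eq0 -scalerBl scaler_eq0 oner_eq0 orbF.
rewrite subr_eq0 => /eqP/(mulfI c_neq0) eq_ij; case/eqP: neq_ji.
exact/val_inj/(natr_inj_pchar pcharKp (ltn_ord j) (ltn_ord i) eq_ij).
Qed.

Lemma artin_schreier_normal_basis : is_normal_basis p sigma (pole 0)^-1.
Proof.
rewrite /is_normal_basis invr_eq0 pole_neq0 basisEfree free_pole_inverses subvf.
by rewrite dim_L size_tuple leqnn.
Qed.

Lemma mul_pole_inverses i j : (i < p)%N -> (j < p)%N ->
  i != j -> (pole i)^-1 * (pole j)^-1 =
    (c * (j%:R - i%:R))^-1 *: ((pole i)^-1 - (pole j)^-1).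
Proof.
move=> lt_i lt_j neq_ij; set d := c * _.
have d_neq0 : d != 0.
  rewrite mulf_neq0 // subr_eq0; apply: contra neq_ij => /eqP eq_ji.
  by apply/eqP/esym/(natr_inj_pchar pcharKp lt_j lt_i).
apply: (scalerI d_neq0); rewrite scalerA mulfV // scale1r.
have -> : (pole i)^-1 - (pole j)^-1 = (pole j - pole i) * ((pole i)^-1 * (pole j)^-1).
  by have := pole_neq0 i; have := pole_neq0 j => ??; field; apply/andP.
by rewrite -mulr_algl /pole opprD addrACA subrr add0r -scalerBl -mulrBr.
Qed.



End NormalBasis.

Lemma sum_period_shift (V : zmodType) p (F : nat -> V) :
  (forall i, F (i + p)%N = F i) ->
  forall k, \sum_(j < p) F (k + j)%N = \sum_(j < p) F j.
Proof.
move=> per; elim=> [//|k IHk]; rewrite -IHk; case: p per {IHk} => [|q] per.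
  by rewrite !big_ord0.
rewrite big_ord_recr [in RHS]big_ord_recl addSnnS per addn0 addrC; congr (_ + _).
by apply: eq_bigr => j _; rewrite addSnnS.
Qed.

(** * The product in the normal basis *)

(** The [y i] stand for the elements of the normal basis, and [D i j] for
[1 / (c (j - i))]; all indices are natural numbers taken modulo [p]. *)
Section ProductFormula.
Variables (K : fieldType) (L : fieldExtType K) (p : nat).
Variables (y : nat -> L) (D : nat -> nat -> K) (s : nat -> K).
Hypothesis y_per : forall i, y (i + p)%N = y i.
Hypothesis s_per : forall i, s (i + p)%N = s i.
Hypothesis D_per : forall i j, D i (j + p)%N = D i j.
Hypothesis D_shift : forall k i j, D (k + i)%N (k + j)%N = D i j.
Hypothesis D_anti : forall i j, D j i = - D i j.
Hypothesis y_mul : forall i j, (i < p)%N -> (j < p)%N -> i != j ->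
  y i * y j = D i j *: (y i - y j).
Hypothesis y_sqr : forall i, y i * y i = \sum_(k < p) s k *: y (i + k)%N.
Variables (alpha beta : nat -> K).
Hypothesis alpha_per : forall i, alpha (i + p)%N = alpha i.
Hypothesis beta_per : forall i, beta (i + p)%N = beta i.

Lemma correlation_of_differences (f : nat -> K) (f_per : forall i, f (i + p)%N = f i) i :
  \sum_(j < p) f j * D i j = \sum_(j < p) D 0 j * f (i + j)%N.
Proof.
rewrite -(sum_period_shift (F := fun j => f j * D i j) _ i) => [|j]; last first.
  by rewrite f_per D_per.
by apply: eq_bigr => j _; rewrite -[X in D X _]addn0 D_shift mulrC.
Qed.

(** The reversal of [s] appears as [s (p.-1 * j)], the factor [p.-1] standing for
-1 modulo [p]. *)
Lemma sum_of_squares (f : nat -> K) (f_per : forall i, f (i + p)%N = f i) :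
  \sum_(i < p) f i *: (y i * y i) =
    \sum_(k < p) (\sum_(j < p) s (p.-1 * j) * f (k + j)%N) *: y k.
Proof.
have shift_sqr (i : 'I_p) : y i * y i = \sum_(k < p) s (p.-1 * i + k)%N *: y k.
  have p_gt0 : (0 < p)%N := leq_ltn_trans (leq0n i) (ltn_ord i).
  rewrite y_sqr -(sum_period_shift (F := fun k => s k *: y (i + k)%N) _ (p.-1 * i)).
    apply: eq_bigr => k _; congr (_ *: _); rewrite -[RHS](periodic_mul y_per i).
    by congr y; rewrite addnA -mulSn prednK // mulnC addnC.
  by move=> k; rewrite s_per addnA y_per.
under eq_bigr do rewrite shift_sqr scaler_sumr.
rewrite exchange_big; apply: eq_bigr => k _ /=.
under eq_bigr do rewrite scalerA; rewrite -scaler_suml; congr (_ *: _).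
rewrite -(sum_period_shift (F := fun i => f i * s (p.-1 * i + k)%N) _ k).
  apply: eq_bigr => j _; rewrite mulrC; congr (_ * _).
  have p_gt0 : (0 < p)%N := leq_ltn_trans (leq0n j) (ltn_ord j).
  rewrite -[RHS](periodic_mul s_per k); congr s.
  by rewrite mulnDr addnAC -mulSnr prednK // addnC [(p * k)%N]mulnC.
by move=> i; rewrite f_per mulnDr addnAC periodic_mul.
Qed.

Lemma product_formula :
  (\sum_(i < p) alpha i *: y i) * (\sum_(j < p) beta j *: y j) =
  \sum_(k < p) (alpha k * (\sum_(j < p) D 0 j * beta (k + j)%N)
              + beta k * (\sum_(j < p) D 0 j * alpha (k + j)%N)
              + \sum_(j < p) s (p.-1 * j) * (alpha (k + j)%N * beta (k + j)%N)) *: y k.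
Proof.
have y_mulE (i j : 'I_p) : y i * y j =
    D i j *: y i + D j i *: y j + (j == i)%:R *: (y i * y i).
  have [->|neq_ij] := eqVneq j i.
    by rewrite scale1r [X in _ + X *: _]D_anti scaleNr subrr add0r.
  rewrite scale0r addr0 y_mul ?ltn_ord 1?eq_sym //.
  by rewrite scalerBr (D_anti i j) scaleNr.
under [RHS]eq_bigr do rewrite !scalerDl.
rewrite !big_split /= -(sum_of_squares (f := fun i => alpha i * beta i)); last first.
  by move=> i; rewrite alpha_per beta_per.
transitivity (\sum_(i < p) (\sum_(j < p) (alpha i * beta j * D i j) *: y i
    + \sum_(j < p) (alpha i * beta j * D j i) *: y j
    + \sum_(j < p) (alpha i * beta j * (j == i)%:R) *: (y i * y i))).
  rewrite big_distrlr; apply: eq_bigr => i _; rewrite -!big_split.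
  apply: eq_bigr => j _ /=.
  rewrite -scalerAr -scalerAl scalerA (y_mulE i j) !scalerDr !scalerA.
  by rewrite [beta _ * _]mulrC.
rewrite !big_split /=; congr (_ + _ + _).
- apply: eq_bigr => i _; rewrite -scaler_suml -correlation_of_differences //.
  by rewrite mulr_sumr; congr (_ *: _); apply: eq_bigr => j _; rewrite mulrA.
- rewrite exchange_big /=; apply: eq_bigr => j _.
  rewrite -scaler_suml -correlation_of_differences // mulr_sumr; congr (_ *: _).
  by apply: eq_bigr => i _; rewrite mulrA [beta _ * _]mulrC.
apply: eq_bigr => i _; rewrite (bigD1 i) //= eqxx mulr1 big1 ?addr0 => [|j neq_ji].
  by rewrite mulrC.
by rewrite (negPf neq_ji) mulr0 scale0r.
Qed.

End ProductFormula.

Section Weight.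
Variables (K : fieldType) (L : fieldExtType K) (p : nat) (Theta : p.-tuple L).
Hypothesis free_Theta : free Theta.
Hypothesis Theta_mul : forall i j : 'I_p, i != j -> exists d : K,
  Theta`_i * Theta`_j = d *: (Theta`_i - Theta`_j).

(** Besides the diagonal, only the pairs with an index equal to 0 can contribute
to the coordinate of index 0. *)
Lemma weight_le : (weight Theta <= 3 * p - 2)%N.
Proof.
case: p Theta free_Theta Theta_mul => [|q] T freeT mulT.
  by rewrite /weight eq_card0 // => -[[]].
pose A := [set (i, i) | i : 'I_q.+1].
pose B := [set (ord0 : 'I_q.+1, lift ord0 j) | j : 'I_q].
pose C := [set (lift ord0 j, ord0 : 'I_q.+1) | j : 'I_q].
apply: (@leq_trans #|A :|: B :|: C|).
  apply/subset_leq_card/fintype.subsetP => -[i j]; rewrite !inE /=.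
  case/existsP=> k /andP[/eqP k0]; rewrite /structure_constant !(tnth_nth 0).
  have {k0} -> : k = ord0 by apply: val_inj.
  have [->|neq_ij] := eqVneq i j; first by rewrite imset_f.
  have [d ->] := mulT _ _ neq_ij; rewrite linearZ linearB /= !coord_free //.
  case: (unliftP ord0 i) => [i'|] ->; last first.
    case: (unliftP ord0 j) => [j'|] ->; last by rewrite subrr mulr0 eqxx.
    by rewrite [(ord0, _) \in B]imset_f ?orbT.
  case: (unliftP ord0 j) => [j'|] ->; first by rewrite subrr mulr0 eqxx.
  by rewrite [(_, ord0) \in C]imset_f ?orbT.
have le_A : (#|A| <= q.+1)%N by rewrite -[X in (_ <= X)%N]card_ord leq_imset_card.
have le_B : (#|B| <= q)%N by rewrite -[X in (_ <= X)%N]card_ord leq_imset_card.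
have le_C : (#|C| <= q)%N by rewrite -[X in (_ <= X)%N]card_ord leq_imset_card.
have := leq_card_setU (A :|: B) C; have := leq_card_setU A B.
by move=> [le_AB _] [le_ABC _]; lia.
Qed.

End Weight.

(** * From computations to programs *)

Section Programs.
Local Open Scope classical_set_scope.
Variables (K : fieldType) (X : Type).
Local Notation V := (X -> K^o).

Definition pointwise_mul (u v : V) : V := fun x => (u x : K) * v x.

Definition values (regs : seq V) (x : X) : seq K := [seq (v x : K) | v <- regs].

Lemma nth_values regs x v : v \in regs -> (values regs x)`_(index v regs) = v x.
Proof. by move=> v_in; rewrite (nth_map 0) ?index_mem ?nth_index. Qed.

Lemma gate_instr regs v : gate pointwise_mul [set` regs] v ->
  exists o : instr K, all (fun i => i < size regs)%N (operands o)
    /\ forall x, exec (values regs x) o = v x.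
Proof.
case=> [u w|u w|c u|u w] /= uin => [win|win||win].
- exists (AddReg K (index u regs) (index w regs)).
  by rewrite /= !index_mem uin win; split=> // x; rewrite /= !nth_values.
- exists (SubReg K (index u regs) (index w regs)).
  by rewrite /= !index_mem uin win; split=> // x; rewrite /= !nth_values.
- exists (MulConst (index u regs) c).
  by rewrite /= !index_mem uin; split=> // x; rewrite /= nth_values // mulrC.
- exists (MulReg K (index u regs) (index w regs)).
  by rewrite /= !index_mem uin win; split=> // x; rewrite /= !nth_values.
Qed.

Lemma circuit_program regs s : circuit pointwise_mul [set` regs] s ->
  exists P : seq (instr K), [/\ size P = size s, well_formed (size regs) P
    & forall x, run P (values regs x) = values (regs ++ s) x].
Proof.
elim: s regs => [|v s IHs] regs /=.
  by move=> _; exists [::]; split=> // x; rewrite cats0.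
case=> /gate_instr[o [wf_o exec_o]] circ.
have /IHs[P [size_P wf_P run_P]] : circuit pointwise_mul [set` rcons regs v] s.
  apply: circuit_sub circ => u /=; rewrite mem_rcons inE.
  by case=> [->|->]; rewrite ?eqxx ?orbT.
exists (o :: P); split=> [||x] /=; first by rewrite size_P.
  by rewrite wf_o -(size_rcons regs v).
by rewrite /run /= exec_o -cat_rcons -run_P /values map_rcons.
Qed.

Lemma computable_program regs c n (out : 'I_n -> V) :
  computable pointwise_mul [set` regs] c (range out) ->
  exists (P : seq (instr K)) (o : n.-tuple nat),
    [/\ (size P <= c)%N, well_formed (size regs) P,
        all (fun i => i < size regs + size P)%N o
      & forall x, [seq (run P (values regs x))`_i | i <- o]
                  = [seq (out k x : K) | k <- enum 'I_n]].
Proof.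
case=> s [size_s /circuit_program[P [size_P wf_P run_P]] sub].
have mem_out k : out k \in regs ++ s.
  have : ([set` regs] `|` [set` s]) (out k) by apply: sub; exists k.
  by rewrite mem_cat; case=> /= ->; rewrite ?orbT.
exists P, [tuple index (out k) (regs ++ s) | k < n]; split=> //.
- by rewrite size_P.
- apply/allP=> _ /mapP[k _ ->].
  by rewrite size_P -size_cat index_mem mem_out.
move=> x; rewrite run_P -map_comp; apply: eq_map => k /=.
by rewrite nth_values.
Qed.

End Programs.

Section Complexity.
Variables (K : fieldType) (L : fieldExtType K) (n : nat) (Theta : n.-tuple L).

(** The existence of a program of a given size is not decidable over an arbitrary
field, hence the classical truth value. *)
Lemma complexity_exists P out :
  computes_product Theta P out -> exists2 c, (c <= size P)%N & is_complexity Theta c.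
Proof.
move=> PP; pose good m := `[< exists Q o, computes_product Theta Q o /\ size Q = m >].
have ex_good : exists m, good m by exists (size P); apply/asboolP; exists P, out.
case: (ex_minnP ex_good) => c /asboolP good_c min_c.
exists c; first by apply: min_c; apply/asboolP; exists P, out.
split=> // Q o QQ; apply: min_c; apply/asboolP; exists Q, o; split=> //.
Qed.

End Complexity.

Section ProductCost.
Local Open Scope classical_set_scope.
Variables (K : fieldType) (L : fieldExtType K) (p : nat) (Theta : p.-tuple L).
Hypothesis basis_Theta : basis_of {:L} Theta.
Hypothesis p_gt0 : (0 < p)%N.
Variables (y : nat -> L) (D : nat -> nat -> K) (s : nat -> K).
Hypothesis y_Theta : forall i : 'I_p, Theta`_i = y i.
Hypothesis y_per : forall i, y (i + p)%N = y i.
Hypothesis s_per : forall i, s (i + p)%N = s i.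
Hypothesis D_per : forall i j, D i (j + p)%N = D i j.
Hypothesis D_shift : forall k i j, D (k + i)%N (k + j)%N = D i j.
Hypothesis D_anti : forall i j, D j i = - D i j.
Hypothesis y_mul : forall i j, (i < p)%N -> (j < p)%N -> i != j ->
  y i * y j = D i j *: (y i - y j).
Hypothesis y_sqr : forall i, y i * y i = \sum_(k < p) s k *: y (i + k)%N.
Variable H : nat.
Local Notation X := (L * L)%type.
Local Notation V := (X -> K^o).
Local Notation mul := (@pointwise_mul K X).
Hypothesis cost : forall (c : nat -> V) U, (forall i, c (i + p)%N = c i) ->
  computable mul (range c) H (range (correlate U c)).

Let ord (i : nat) : 'I_p := Ordinal (ltn_pmod i p_gt0).

Let ord_per i : ord (i + p) = ord i.
Proof. by apply: val_inj; rewrite /= modnDr. Qed.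

Let ord_id (i : 'I_p) : ord i = i.
Proof. by apply: val_inj; rewrite /= modn_small. Qed.

Let expand (a : L) : a = \sum_(i < p) coord Theta (ord i) a *: y i.
Proof.
rewrite [LHS](coord_basis basis_Theta (memvf a)).
by apply: eq_bigr => i _; rewrite y_Theta ord_id.
Qed.

(** Three correlations, [p] products for the third one, and then four operations
for each coordinate. *)
Lemma normal_basis_complexity :
  exists2 c, (c <= 3 * H + 5 * p)%N & is_complexity Theta c.
Proof.
pose alpha i : V := fun ab => coord Theta (ord i) ab.1.
pose beta i : V := fun ab => coord Theta (ord i) ab.2.
pose gamma i := mul (alpha i) (beta i).
have alpha_per i : alpha (i + p)%N = alpha i by rewrite /alpha ord_per.
have beta_per i : beta (i + p)%N = beta i by rewrite /beta ord_per.
have gamma_per i : gamma (i + p)%N = gamma i by rewrite /gamma alpha_per beta_per.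
pose U := [seq (D 0 j, j) | j <- iota 0 p].
pose W := [seq (s (p.-1 * j), j) | j <- iota 0 p].
pose out (k : 'I_p) : V := fun ab => coord Theta k (ab.1 * ab.2).
pose regs : seq V :=
  [seq alpha i | i : 'I_p <- enum 'I_p] ++ [seq beta i | i : 'I_p <- enum 'I_p].
set S := [set` regs].
have outE k : out k = mul (alpha k) (correlate U beta k)
    + mul (beta k) (correlate U alpha k) + correlate W gamma k.
  apply: funext => -[a b]; rewrite /out /= {1}[a]expand {1}[b]expand.
  rewrite (product_formula y_per s_per D_per D_shift D_anti y_mul y_sqr
    (alpha := fun i => coord Theta (ord i) a) (beta := fun i => coord Theta (ord i) b));
    try by move=> i; rewrite ord_per.
  under eq_bigr do rewrite -y_Theta.
  rewrite coord_sum_free ?(basis_free basis_Theta) //.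
  by rewrite !correlate_iota; rewrite !fctE /pointwise_mul !fct_sumE.
have S_alpha i : S (alpha i).
  rewrite /S /= mem_cat; apply/orP; left; apply/mapP; exists (ord i).
    by rewrite mem_enum.
  by rewrite /alpha ord_id.
have S_beta i : S (beta i).
  rewrite /S /= mem_cat; apply/orP; right; apply/mapP; exists (ord i).
    by rewrite mem_enum.
  by rewrite /beta ord_id.
have c_alpha : computable mul S H (range (correlate U alpha)).
  by apply: computable_sub (cost U alpha_per) => // _ [i _ <-].
have c_beta : computable mul S H (range (correlate U beta)).
  by apply: computable_sub (cost U beta_per) => // _ [i _ <-].
have c_gamma : computable mul S (p * 1) (range gamma).
  have := computable_bigcup (n := p) (T := fun i => [set gamma i]) (S := S)
    (fun i _ => computable_gate (GateMul mul (S_alpha i) (S_beta i))).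
  apply: computable_sub => // _ [i _ <-]; exists (i %% p)%N; first by rewrite /= ltn_mod.
  by rewrite /= {1}(divn_eq i p) addnC (periodic_mul gamma_per).
have c_conv := computableU (computableU c_alpha c_beta)
                 (computable_trans c_gamma (cost W gamma_per)).
set T := _ `|` _ in c_conv.
have c_out : computable mul (S `|` T) (p * 4) (\bigcup_(k in `I_p) [set out (ord k)]).
  apply: computable_bigcup => k _; rewrite outE.
  have c1 : computable mul (S `|` T) 1
      [set mul (alpha (ord k)) (correlate U beta (ord k))].
    by apply/computable_gate/GateMul; [left | right; left; right; eexists].
  have c2 : computable mul (S `|` T) 1
      [set mul (beta (ord k)) (correlate U alpha (ord k))].
    by apply/computable_gate/GateMul; [left | right; left; left; eexists].
  have c3 : computable mul (S `|` T) 0 [set correlate W gamma (ord k)].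
    by apply: computable_id => _ ->; right; right; eexists.
  exact: computable_add (computable_add c1 c2) c3.
have c_all : computable mul [set` regs] (3 * H + 5 * p) (range out).
  apply: computable_sub (computableD c_conv c_out) => // [_ [k _ <-]|]; last by lia.
  by right; exists k; rewrite /= ?ord_id.
have [P [o [size_P wf_P o_lt runP]]] := computable_program c_all.
have size_regs : size regs = (p + p)%N by rewrite size_cat 2!size_map size_enum_ord.
rewrite size_regs in wf_P o_lt.
have P_computes : computes_product Theta P o.
  split=> // a b; apply: etrans (runP (a, b)); apply: eq_map => i; congr (_`_i).
  congr (run P _); rewrite /values map_cat /coordinates.
  rewrite -!(map_comp (fun v : V => v (a, b) : K)).
  by congr (_ ++ _); apply: eq_map => k /=; rewrite /alpha /beta ord_id.
have [c le_c c_Theta] := complexity_exists P_computes.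
by exists c => //; apply: leq_trans size_P.
Qed.

End ProductCost.

(** * The bound as a function of p *)

(** This is the cost of [cyclic_correlation_cost] with that of
[fast_correlation_cost], for the exponents [m] and [d] with
[2 p <= 2 ^ m <= 4 p] and [m <= 2 ^ d <= 2 m]. *)
Definition fast_bound (p : nat) : nat :=
  let m := (trunc_log 2 p).+2 in let d := (trunc_log 2 m).+1 in
  (p + 12 * 2 ^ m * (2 ^ d * d.+1))%N.

(** For [p = 2] the value 10 is that of [naive_correlation_cost]. *)
Definition correlation_bound (p : nat) : nat :=
  if (p == 2)%N then 10%N else fast_bound p.

Section Asymptotics.
Variable R : realType.

Lemma ln2_lt1 : ln 2 < 1 :> R.
Proof.
have : (1 + 1 : R) < expR 1 by apply: expR_gt1Dx; rewrite oner_neq0.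
by rewrite -(ltr_ln _ _) ?posrE ?expR_gt0 // ?expRK // addr_gt0.
Qed.

(** The inequality [e < 3] is obtained as [e <= (6 / 5) ^ 6 < 3], from
[ln (5 / 6) <= - 1 / 6]. *)
Lemma ln3_gt1 : 1 < ln 3 :> R.
Proof.
have ln_65 : 1 / 6 <= ln (6 / 5) :> R.
  have -> : 6 / 5 = (5 / 6)^-1 :> R by rewrite invf_div.
  rewrite lnV ?posrE ?divr_gt0 // lerNr.
  have := @le_ln1Dx R (- (1 / 6)); rewrite ltrN2 => /(_ _).
  have -> : 1 - 1 / 6 = 5 / 6 :> R by field.
  by apply; lra.
apply: (@le_lt_trans _ _ (ln ((6 / 5) ^+ 6))).
  by rewrite lnXn ?divr_gt0 //; move: ln_65; rewrite -mulr_natr; lra.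
by rewrite ltr_ln ?posrE ?exprn_gt0 ?divr_gt0 //; lra.
Qed.

Lemma trunc_log2_le n : (0 < n)%N -> (trunc_log 2 n)%:R * ln 2 <= ln n%:R :> R.
Proof.
move=> n_gt0; rewrite mulrC mulr_natr -lnXn // ler_ln ?posrE ?exprn_gt0 ?ltr0n //.
by rewrite -natrX ler_nat trunc_logP.
Qed.

Lemma fast_bound_le p : (1 < p)%N ->
  let m := (trunc_log 2 p).+2 in
  (fast_bound p <= 97 * (p * (m * (trunc_log 2 m).+2)))%N.
Proof.
move=> p_gt1; rewrite /fast_bound.
set m := (trunc_log 2 p).+2; move=> /=; set d := (trunc_log 2 m).+1.
have le_m : (2 ^ m <= 4 * p)%N.
  by rewrite !expnS mulnA leq_mul2l /= trunc_logP // ltnW.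
have le_d : (2 ^ d <= 2 * m)%N by rewrite expnS leq_mul2l /= trunc_logP.
have le1 : (12 * 2 ^ m * (2 ^ d * d.+1) <= 12 * (4 * p) * (2 * m * d.+1))%N.
  by apply: leq_mul; apply: leq_mul.
have le2 : (p * 1 <= p * (m * d.+1))%N by rewrite leq_mul2l muln_gt0 orbT.
lia.
Qed.

(** The bound is a multiple of [p m (d + 1)], where [m] is of order [log p] and [d]
of order [log m], up to additive constants; these are absorbed in multiplicative
ones, as [ln p] and
[ln (ln p)] are bounded below by [1] and [ln (ln 3) > 0]. *)
Lemma fast_bound_asymptotics : exists2 C : R, 0 < C &
  forall p, (2 < p)%N -> (fast_bound p)%:R <= C * (p%:R * ln p%:R * ln (ln p%:R)).
Proof.
have ln2_gt0 : 0 < ln 2 :> R by rewrite ln_gt0 // ltr1n.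
pose delta : R := ln (ln 3); have delta_gt0 : 0 < delta by rewrite ln_gt0 ?ln3_gt1.
pose c1 : R := (ln 2)^-1 + 2.
have c1_ge1 : 1 <= c1.
  by rewrite /c1; move: ln2_gt0; rewrite -invr_gt0; move: _^-1 => t; lra.
have c1_gt0 : 0 < c1 by apply: lt_le_trans c1_ge1.
pose c2 : R := (ln c1 / delta + 1) / ln 2 + 2 / delta.
have c2_gt0 : 0 < c2.
  have ge0 : 0 <= ln c1 / delta by rewrite divr_ge0 ?(ltW delta_gt0) ?ln_ge0.
  by rewrite addr_gt0 ?divr_gt0 //; apply: le_lt_trans ge0 _; rewrite ltrDl.
exists (97 * (c1 * c2)); first by rewrite !mulr_gt0 // ltr0n.
move=> p p_gt2; have p_gt1 : (1 < p)%N by apply: ltnW.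
have le_ln3 : ln 3 <= ln p%:R :> R by rewrite ler_ln ?posrE ?ltr0n ?ler_nat // ltnW.
have ln_gt1 : 1 < ln p%:R :> R by apply: lt_le_trans le_ln3; apply: ln3_gt1.
have ln_gt0 : 0 < ln p%:R :> R by apply: lt_trans ln_gt1.
have le_delta : delta <= ln (ln p%:R).
  by rewrite ler_ln ?posrE // (lt_trans _ ln3_gt1).
set lp := ln p%:R in le_ln3 ln_gt1 ln_gt0 le_delta *.
set m := (trunc_log 2 p).+2.
have le_m : m%:R <= c1 * lp.
  rewrite /m -addn2 natrD mulrDl lerD //; last by rewrite ler_peMr // ltW.
  by rewrite mulrC ler_pdivlMr // trunc_log2_le // ltnW.
have le_d : ((trunc_log 2 m).+2)%:R <= c2 * ln lp.
  have : (trunc_log 2 m)%:R * ln 2 <= ln c1 + ln lp.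
    apply: le_trans (trunc_log2_le (ltn0Sn _)) _.
    by rewrite -lnM ?posrE // ler_ln ?posrE ?mulr_gt0 ?ltr0n.
  rewrite -ler_pdivlMr // => le_t.
  have le1 : ln c1 <= ln c1 / delta * ln lp.
    by rewrite mulrAC ler_pdivlMr // ler_wpM2l // ln_ge0.
  have le2 : 2 <= 2 / delta * ln lp by rewrite mulrAC ler_pdivlMr // ler_wpM2l.
  rewrite -addn2 natrD /c2 [leRHS]mulrDl lerD //.
  apply: le_trans le_t _; rewrite mulrAC ler_wpM2r ?invr_ge0 ?(ltW ln2_gt0) //.
  by rewrite mulrDl mul1r lerD2r.
apply: le_trans (_ : (97 * (p * (m * (trunc_log 2 m).+2)))%:R <= _).
  by rewrite ler_nat; apply: fast_bound_le.
have -> : 97 * (c1 * c2) * (p%:R * lp * ln lp) =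
    97 * (p%:R * ((c1 * lp) * (c2 * ln lp))) by ring.
by rewrite !natrM ler_wpM2l // ler_wpM2l ?ler0n // ler_pM ?ler0n.
Qed.

(** Only [p = 2] has to be treated apart: there [ln (ln p)] is negative, and the
bound amounts to its not being 0. *)
Lemma product_bound_asymptotics : exists C : R, forall p, prime p ->
  (3 * correlation_bound p + 5 * p)%N%:R <=
    C * (p%:R * ln p%:R * `|ln `|ln p%:R : R| |).
Proof.
have ln2_gt0 : 0 < ln 2 :> R by rewrite ln_gt0 // ltr1n.
have [C C_gt0 boundC] := fast_bound_asymptotics.
pose B2 : R := 2 * ln 2 * `|ln (ln 2)|.
have B2_gt0 : 0 < B2.
  by rewrite !mulr_gt0 // normr_gt0 lt_eqF // ln_lt0 // ln2_gt0 ln2_lt1.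
exists (8 * C + 40 / B2) => p p_pr; rewrite /correlation_bound.
have [->|p_neq2] := eqVneq p 2%N.
  rewrite [`|ln 2|]gtr0_norm // -/B2 mulrDl divfK ?gt_eqF //.
  by rewrite lerDr mulr_ge0 ?mulr_ge0 // ltW.
have p_gt2 : (2 < p)%N by rewrite ltn_neqAle eq_sym p_neq2 prime_gt1.
have le_ln3 : ln 3 <= ln p%:R :> R.
  by rewrite ler_ln ?posrE ?ltr0n ?ler_nat // ltnW // ltnW.
have ln_gt1 : 1 < ln p%:R :> R by apply: lt_le_trans le_ln3; apply: ln3_gt1.
rewrite [`|ln p%:R|]gtr0_norm ?(lt_trans _ ln_gt1) //.
have lnln_gt0 : 0 < ln (ln p%:R) :> R by rewrite ln_gt0.
rewrite gtr0_norm //; set B := _ * ln (ln _).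
have B_gt0 : 0 < B by rewrite !mulr_gt0 ?ltr0n ?prime_gt0 // (lt_trans _ ln_gt1).
apply: (@le_trans _ _ (8 * (fast_bound p)%:R)).
  rewrite -natrM ler_nat; have : (p <= fast_bound p)%N by apply: leq_addr.
  lia.
rewrite [leRHS]mulrDl -mulrA ler_wpDr //; last by rewrite ler_wpM2l ?boundC.
by rewrite mulr_ge0 ?divr_ge0 // ltW.
Qed.

End Asymptotics.

(** * Weight and complexity of the normal basis *)

Section NormalBasisCost.
Variables (K : fieldType) (L : splittingFieldType K) (p : nat) (x : L).
Hypothesis pcharKp : p \in [pchar K].
Hypothesis gen_x : <<1; x>>%VS = {:L}%VS.
Hypothesis dim_L : \dim {:L} = p.
Variables (sigma : gal_of {:L}) (c : K).
Hypothesis c_neq0 : c != 0.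
Hypothesis sigma_x : sigma x = x + c%:A.
Local Notation Theta := (galois_conjugates p sigma (pole x c 0)^-1).

Let p_pr : prime p := pcharf_prime pcharKp.
Let p_gt0 : (0 < p)%N := prime_gt0 p_pr.
Let basis_Theta : basis_of {:L} Theta.
Proof.
by have /andP[] := artin_schreier_normal_basis pcharKp gen_x dim_L c_neq0 sigma_x.
Qed.

Lemma artin_schreier_weight : (weight Theta <= 3 * p - 2)%N.
Proof.
apply: weight_le; first exact: basis_free basis_Theta.
move=> i j neq_ij; exists (c * (j%:R - i%:R))^-1.
by rewrite !nth_galois_conjugates // (mul_pole_inverses pcharKp).
Qed.

Lemma cyclic_correlation_bound (X : Type) :
  forall (y : nat -> X -> K^o) U, (forall i, y (i + p)%N = y i) ->
  computable (@pointwise_mul K X) (range y) (correlation_bound p)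
             (range (correlate U y)).
Proof.
move=> y U y_per; rewrite /correlation_bound; have [p2|p_neq2] := eqVneq p 2%N.
  rewrite -(_ : p * p.*2.+1 = 10)%N ?p2 // -p2.
  by apply: (@naive_correlation_cost _ _ _ p 1 p) => // i; rewrite scale1r.
have two_neq0 : 2%:R != 0 :> K.
  apply: contra p_neq2; rewrite -(dvdn_pcharf pcharKp) => dv2.
  by rewrite eqn_leq dvdn_leq // prime_gt1.
apply: (@cyclic_correlation_cost _ _ _ two_neq0 p (trunc_log 2 p).+2) => //.
  by rewrite expnS leq_mul2l /= ltnW // trunc_log_ltn.
by apply: fast_correlation_cost => //; rewrite ltnW // trunc_log_ltn.
Qed.

Lemma artin_schreier_complexity :
  exists2 k, (k <= 3 * correlation_bound p + 5 * p)%N & is_complexity Theta k.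
Proof.
pose y i := (pole x c i)^-1; pose D i j := (c * (j%:R - i%:R))^-1.
pose s k := coord Theta (Ordinal (ltn_pmod k p_gt0)) (y 0%N * y 0%N).
have y_sqr i : y i * y i = \sum_(k < p) s k *: y (i + k)%N.
  have -> : y i = (sigma ^+ i)%g (y 0%N).
    by rewrite (galX_pole sigma_x).
  rewrite -rmorphM [y 0%N * _](coord_basis basis_Theta (memvf _)) /= linear_sum.
  apply: eq_bigr => k _; rewrite linearZ /= nth_galois_conjugates // (galX_pole sigma_x).
  rewrite addnC; congr (coord _ _ _ *: _); apply: val_inj.
  by rewrite /= modn_small.
have [] := normal_basis_complexity basis_Theta p_gt0 (y := y) (D := D) (s := s)
  (nth_galois_conjugates sigma_x) _ _ _ _ _ _ y_sqr (@cyclic_correlation_bound _).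
- by move=> i; rewrite /y pole_periodic.
- by move=> i; congr (coord _ _ _); apply: val_inj; rewrite /= modnDr.
- by move=> i j; rewrite /D natrD (pcharf0 pcharKp) addr0.
- by move=> k i j; rewrite /D !natrD opprD addrACA subrr add0r.
- by move=> i j; rewrite /D -opprB mulrN invrN.
- by move=> i j; apply: mul_pole_inverses.
by move=> k le_k k_Theta; exists k.
Qed.

End NormalBasisCost.

Theorem theorem1p1 (R : realType) :
  exists C : R,
  forall (K : fieldType) (p : nat) (a : K),
    p \in [pchar K] ->
    ~ (exists x : K, a = x ^+ p - x) ->
    exists (hI : monic_irreducible_poly ('X^p - 'X - a%:P))
           (hS : SplittingField.axiom {poly %/ 'X^p - 'X - a%:P with hI}),
    let L := splitting_of hS in
    [/\ galois 1%AS {:L},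
        cyclic 'Gal({:L} / 1%AS),
        \dim {:L} = p
      & forall sigma : gal_of {:L},
          generator 'Gal({:L} / 1%AS) sigma ->
          exists theta : L,
            [/\ is_normal_basis p sigma theta,
                (weight (galois_conjugates p sigma theta) <= 3 * p - 2)%N
              & exists2 c : nat,
                  is_complexity (galois_conjugates p sigma theta) c
                & c%:R <= C * (p%:R * ln p%:R * `|ln `|ln p%:R : R| |)]].
Proof.
have [C boundC] := product_bound_asymptotics R; exists C => K p a pcharKp no_root.
have hI : monic_irreducible_poly ('X^p - 'X - a%:P).
  split; first exact: artin_schreier_irreducible.
  exact: monic_artin_schreier.
have hS : SplittingField.axiom {poly %/ 'X^p - 'X - a%:P with hI}.
  exists (map_poly (in_alg _) ('X^p - 'X - a%:P)); first exact: artin_schreier_over.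
  apply: artin_schreier_splits pcharKp _ _; first exact: qfpoly_artin_schreier.
  exact: qfpoly_generated.
exists hI, hS => L; pose x : L := 'qX : {poly %/ 'X^p - 'X - a%:P with hI}.
have root_x : x ^+ p - x = a%:A := qfpoly_artin_schreier hI.
have gen_x : <<1; x>>%VS = {:L}%VS := qfpoly_generated hI.
have dim_L : \dim {:L} = p.
  by rewrite [LHS](dim_qfpoly hI) size_artin_schreier.
split=> //.
- exact: artin_schreier_galois root_x gen_x.
- exact: artin_schreier_cyclic root_x gen_x dim_L.
move=> sigma gen_sigma.
have [c c_neq0 sigma_x] := artin_schreier_generator pcharKp root_x gen_x dim_L gen_sigma.
exists (pole x c 0)^-1; split.
- exact: artin_schreier_normal_basis.
- exact: artin_schreier_weight.
have [k le_k k_complexity] :=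
  artin_schreier_complexity pcharKp gen_x dim_L c_neq0 sigma_x.
exists k => //; apply: le_trans (boundC p (pcharf_prime pcharKp)).
by rewrite ler_nat.
Qed.
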